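(* Let $K$ be a field of characteristic zero, $d\in\mathbb{N}$, $R=K[x_1,\ldots,x_d]$ and $S=K[y_1,\ldots,y_d]$. Let $M$ be a non-empty set of monomials of $R$ that are pairwise non-comparable with respect to divisibility, and let $M'\subseteq S$ be the corresponding set of monomials of $S$, obtained by replacing each $x_i$ by $y_i$. Let $I$ be the unique zero-dimensional monomial ideal of $R$ with $\partial\mathrm{oc}(I)=M$. Then the inverse ideal ${M'}^{-1}=\mathrm{Ann}(M')=\{f\in R : f\circ g'=0 \text{ for each } g'\in M'\}$ is equal to $I$.
   Context: The ring $R$ acts $K$-linearly on $S$ by differentiation: $x_i$ acts as $\partial/\partial y_i$, so $\tilde{x}^{\tilde{p}}\circ\tilde{y}^{\tilde{q}}=0$ if $\tilde{p}\not\leq\tilde{q}$ componentwise, and $\tilde{x}^{\tilde{p}}\circ\tilde{y}^{\tilde{q}}=\prod_{i=1}^d\frac{q_i!}{(q_i-p_i)!}\,\tilde{y}^{\tilde{q}-\tilde{p}}$ if $\tilde{p}\leq\tilde{q}$. Here $\tilde{x}^{\tilde{p}}=x_1^{p_1}\cdots x_d^{p_d}$. For a monomial ideal $I\subseteq R$ and $\mathfrak{m}=(x_1,\ldots,x_d)$, the socle is $\mathrm{Soc}(I)=(I:\mathfrak{m})$, and the docle $\partial\mathrm{oc}(I)$ is the set of monomials in $\mathrm{Soc}(I)\setminus I$; i.e. the set of monomials $a\notin I$ with $x_ia\in I$ for all $i$. An ideal $I$ of $R$ is zero-dimensional if $R/I$ is a finite-dimensional $K$-vector space. It is a known result that for each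 non-empty set $M$ of pairwise non-comparable monomials of $R$ there is a unique zero-dimensional monomial ideal $I$ of $R$ with $\partial\mathrm{oc}(I)=M$. *)

(* Defs.v *)
From HB Require Import structures.
From mathcomp Require Import all_boot all_order all_algebra.
From mathcomp Require Import boolp classical_sets.
From mathcomp Require Import mpoly.

Set Implicit Arguments.
Unset Strict Implicit.
Unset Printing Implicit Defensive.

Import GRing.Theory.

Local Open Scope ring_scope.
Local Open Scope classical_set_scope.

(* Both R = K[x_1,..,x_d] and S = K[y_1,..,y_d] are represented by
   {mpoly K[d]}.  A monomial is represented by its exponent vector in
   'X_{1..d}; the corresponding element of R or S is 'X_[m], so the
   replacement of each x_i by y_i is the identity on exponents. *)

Section Ideals.
Variables (K : fieldType) (d : nat).
Implicit Types (A I J : set {mpoly K[d]}) (M : set 'X_{1..d}).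

(* ring_quotient's idealr_closed is not used: it is restricted to boolean
   predicates and to proper ideals. *)
Definition is_ideal I : Prop :=
  [/\ I 0,
      forall f g, I f -> I g -> I (f + g) &
      forall f g, I g -> I (f * g)].

Definition ideal_gen A : set {mpoly K[d]} := smallest is_ideal A.

Definition monomials M : set {mpoly K[d]} := (fun m => 'X_[m]) @` M.

Definition monomial_ideal I : Prop :=
  exists M, I = ideal_gen (monomials M).

Definition max_ideal : set {mpoly K[d]} := ideal_gen (range (fun i => 'X_i)).

Definition colon_ideal I J : set {mpoly K[d]} :=
  [set f | forall g, J g -> I (f * g)].

Definition socle I : set {mpoly K[d]} := colon_ideal I max_ideal.

Definition docle I : set 'X_{1..d} := [set a | (socle I `\` I) 'X_[a]].

(* The K-vector space {mpoly K[d]} / I is finite-dimensional: the classes of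
   finitely many polynomials span it. *)
Definition zero_dimensional I : Prop :=
  exists s : seq {mpoly K[d]}, forall f : {mpoly K[d]},
    exists c : nat -> K, I (f - \sum_(i < size s) c i *: s`_i).

End Ideals.

Arguments max_ideal : clear implicits.

(* (a <= b)%MM is divisibility of monomials. *)
Lemma lem_dvdP (K : fieldType) (d : nat) (a b : 'X_{1..d}) :
  (a <= b)%MM <-> exists h : {mpoly K[d]}, 'X_[b] = 'X_[a] * h.
Proof.
split=> [le_ab|[h e]].
  by exists 'X_[b - a]; rewrite -mpolyXD addmC submK.
have: b \in msupp ('X_[b] : {mpoly K[d]}) by rewrite msuppX mem_seq1.
rewrite e mulrC (perm_mem (msuppMX h a)) => /mapP[m _ ->].
exact: lem_addr.
Qed.

Definition antichain (d : nat) (M : set 'X_{1..d}) : Prop :=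
  forall a b, M a -> M b -> (a <= b)%MM -> a = b.

Section Action.
Variables (K : fieldType) (d : nat).

(* f o g, where x_i acts as d/dy_i. *)
Definition diff_act (f g : {mpoly K[d]}) : {mpoly K[d]} :=
  \sum_(m <- msupp f) f@_m *: g^`M[m].

Lemma diff_actX (p q : 'X_{1..d}) :
  diff_act 'X_[p] 'X_[q] =
  if (p <= q)%MM
  then (\prod_(i < d) ((q i)`! %/ (q i - p i)`!))%:R *: 'X_[q - p]
  else 0.
Proof.
rewrite /diff_act msuppX big_seq1 mcoeffX eqxx scale1r mderivmX.
case: ifPn => [/mnm_lepP le_pq | nle_pq].
  by congr (_%:R *: _); apply: eq_bigr => i _; rewrite ffact_factd.
have [i lt_qp] : exists i, (q i < p i)%N.
  by move: nle_pq => /forallPn[i]; rewrite -ltnNge; exists i.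
by rewrite (bigD1 i) //= ffact_small // mul0n scale0r.
Qed.

Definition annihilator (G : set {mpoly K[d]}) : set {mpoly K[d]} :=
  [set f | forall g, G g -> diff_act f g = 0].

End Action.

(* Main.v *)
(* Both sides are monomial: [f] lies in [I] iff every monomial of [f] does, and
   in characteristic zero [f] annihilates [y^q] iff no monomial of [f] divides
   [x^q].  So it suffices that a monomial lies outside [I] iff it divides an
   element of the docle.  If [a] is outside [I] and divides no element of the
   docle, repeatedly multiplying by a suitable variable gives an infinite chain
   of monomials outside [I]; these are linearly independent modulo [I], against
   zero-dimensionality. *)
Require Import Defs.
From HB Require Import structures.
From mathcomp Require Import all_boot all_order all_algebra.
From mathcomp Require Import boolp classical_sets.
From mathcomp Require Import mpoly.

Import GRing.Theory.

Local Open Scope ring_scope.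
Local Open Scope classical_set_scope.

Section IdealTheory.
#[local] Set Implicit Arguments.
#[local] Unset Strict Implicit.

Variables (K : fieldType) (d : nat).
Implicit Types (A I : set {mpoly K[d]}) (f g : {mpoly K[d]}).

Lemma ideal_gen_is_ideal A : is_ideal (ideal_gen A).
Proof.
split=> [J [[J0 _ _] _] //|f g If Ig J JA|f g Ig J JA].
  by have [[_ JD _] _] := JA; apply: JD; [apply: If | apply: Ig].
by have [[_ _ JM] _] := JA; apply: JM; apply: Ig.
Qed.

Lemma is_idealZ I (c : K) f : is_ideal I -> I f -> I (c *: f).
Proof. by case=> _ _ IM If; rewrite -mul_mpolyC; apply: IM. Qed.

Lemma is_ideal_sum I (T : eqType) (r : seq T) (F : T -> {mpoly K[d]}) :
  is_ideal I -> (forall x, x \in r -> I (F x)) -> I (\sum_(x <- r) F x).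
Proof.
case=> I0 ID _ IF; rewrite big_seq; elim/big_ind: _ => //.
Qed.

Lemma is_ideal_mpolyX_dvd I (a b : 'X_{1..d}) :
  is_ideal I -> (a <= b)%MM -> I 'X_[a] -> I 'X_[b].
Proof. by case=> _ _ IM le_ab Ia; rewrite -(submK le_ab) mpolyXD; apply: IM. Qed.

Lemma monomial_ideal_is_ideal I : monomial_ideal I -> is_ideal I.
Proof. by case=> N ->; exact: ideal_gen_is_ideal. Qed.

(** The polynomials all of whose monomials lie in [I] form an ideal containing the monomial
    generators of [I], hence all of [I]. *)
Lemma monomial_idealP I f :
  monomial_ideal I -> I f <-> forall m, m \in msupp f -> I 'X_[m].
Proof.
move=> I_mon; have idI := monomial_ideal_is_ideal I_mon.
split=> [|If]; last first.
  by rewrite (mpolyE f); apply: is_ideal_sum => // m /If; exact: is_idealZ.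
case: I_mon => N eI; rewrite {1}eI => If.
pose J : set {mpoly K[d]} := [set g | forall m, m \in msupp g -> I 'X_[m]].
suff: J f by [].
apply: If; split; last first.
  move=> _ [n Nn <-] m; rewrite msuppX mem_seq1 => /eqP ->.
  by rewrite eI => B [_]; apply; exists n.
split=> [m|g h Jg Jh m|g h Jh m]; first by rewrite msupp0.
  by move=> /msuppD_le; rewrite mem_cat => /orP[/Jg|/Jh].
move=> /msuppM_le /allpairsP[[m1 m2] /= [_ m2h ->]].
by apply: (is_ideal_mpolyX_dvd (a := m2)) (Jh _ m2h); rewrite ?lem_addl.
Qed.

(** Testing on the variables suffices: the [h] with ['X_[a] * h] in [I] form an ideal, which
    contains [max_ideal] once it contains every variable. *)
Lemma docleP I (a : 'X_{1..d}) : is_ideal I ->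
  docle I a <-> ~ I 'X_[a] /\ forall i, I 'X_[a + U_(i)].
Proof.
move=> idI; split=> [[Sa nIa]|[nIa Ia]].
  split=> // i; rewrite mpolyXD; apply: Sa => B [_]; apply.
  by exists i.
split=> // g /(_ [set h | I ('X_[a] * h)]); apply; split; last first.
  by move=> _ [i _ <-]; rewrite /= -mpolyXD.
case: idI => I0 ID IM; split=> /= [|f h If Ih|f h Ih].
- by rewrite mulr0.
- by rewrite mulrDr; apply: ID.
- by rewrite mulrCA; apply: IM.
Qed.

(** If [n] classes span the quotient, then [n.+1] of the monomials [m k] have a nontrivial
    combination in [I]; as [I] is monomial, each monomial occurring in it lies in [I]. *)
Lemma zero_dimensional_chain I (m : nat -> 'X_{1..d}) :
  monomial_ideal I -> zero_dimensional I -> injective m ->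
  exists k, I 'X_[m k].
Proof.
move=> I_mon [s sP] m_inj; have idI := monomial_ideal_is_ideal I_mon.
have [c cP] := choice (fun k => sP 'X_[m k]).
pose n := size s; pose A : 'M[K]_(n.+1, n) := \matrix_(k, i) c k i.
(* [A] has more rows than columns, so its rows are linearly dependent. *)
have /rowV0Pn[u /sub_kermxP uA0 u0] : kermx A != 0.
  rewrite kermx_eq0 /row_free neq_ltn.
  by rewrite (leq_ltn_trans (rank_leq_col A)).
have /rV0Pn[k uk0] := u0.
pose f : {mpoly K[d]} := \sum_(j < n.+1) u 0 j *: 'X_[m j].
have If : I f.
  have -> : f = \sum_(j < n.+1)
      u 0 j *: ('X_[m j] - \sum_(i < n) c j i *: s`_i).
    under [RHS]eq_bigr do rewrite scalerBr scaler_sumr.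
    rewrite sumrB exchange_big /= [X in _ - X]big1 ?subr0 // => i _.
    under eq_bigr do rewrite scalerA.
    have /matrixP/(_ 0 i) := uA0; rewrite !mxE => uA0i.
    rewrite -scaler_suml [X in X *: _](_ : _ = 0) ?scale0r //.
    by rewrite -[RHS]uA0i; apply: eq_bigr => j _; rewrite mxE.
  by apply: is_ideal_sum => // j _; apply: is_idealZ.
exists k; apply: (iffLR (monomial_idealP _ I_mon) If).
(* By injectivity of [m], the coefficient of [f] at [m k] is exactly [u 0 k]. *)
rewrite mcoeff_msupp raddf_sum (bigD1 k) //= mcoeffZ mcoeffX eqxx mulr1.
rewrite big1 ?addr0 // => j jk; rewrite mcoeffZ mcoeffX.
by rewrite (inj_eq m_inj) (inj_eq val_inj) (negPf jk) mulr0.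
Qed.

Lemma dvd_docle I (a : 'X_{1..d}) :
  monomial_ideal I -> zero_dimensional I -> ~ I 'X_[a] ->
  exists2 q, docle I q & (a <= q)%MM.
Proof.
move=> I_mon I_zd nIa; apply: contrapT => noq.
have idI := monomial_ideal_is_ideal I_mon.
pose above (b : 'X_{1..d}) := ~ I 'X_[b] /\ (a <= b)%MM.
pose T := {b | above b}.
have next (b : T) : exists b' : T, exists i, sval b' = (sval b + U_(i))%MM.
  case: b => b [nIb le_ab] /=.
  (* Otherwise [b] itself would be an element of the docle above [a]. *)
  have [i nIbi] : exists i, ~ I 'X_[b + U_(i)].
    apply/existsNP => Ib; apply: noq; exists b => //.
    by apply/docleP.
  have P : above (b + U_(i))%MM.
    by split=> //; exact: lepm_trans le_ab (lem_addr _ _).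
  by exists (exist above _ P), i.
have [F FP] := choice next.
pose a0 : T := exist above a (conj nIa (lepm_refl a)).
(* Degrees grow by one along this chain, so its terms are distinct. *)
pose b k := sval (iter k F a0).
have deg_b k : mdeg (b k) = (mdeg a + k)%N.
  elim: k => [|k IH]; first by rewrite addn0.
  rewrite /b /=; have [i ->] := FP (iter k F a0).
  by rewrite mdegD mdeg1 IH addn1 addnS.
have b_inj : injective b.
  by move=> j k /(congr1 mdeg); rewrite !deg_b => /addnI.
have [k] := zero_dimensional_chain I_mon I_zd b_inj.
by have [nI _] := svalP (iter k F a0).
Qed.

End IdealTheory.

Section Annihilator.
#[local] Set Implicit Arguments.
#[local] Unset Strict Implicit.

Variables (K : fieldType) (d : nat).
Hypothesis charK0 : [pchar K] =i pred0.

(** Distinct divisors [m] of [q] give distinct monomials [q - m], so nothing cancels, and the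
    falling factorials [c m] are nonzero in characteristic zero. *)
Lemma diff_act_mpolyX_eq0 (f : {mpoly K[d]}) (q : 'X_{1..d}) :
  diff_act f 'X_[q] = 0 <-> forall m, m \in msupp f -> ~~ (m <= q)%MM.
Proof.
pose c m : K := (\prod_(i < d) (q i) ^_ (m i))%:R.
have actE : diff_act f 'X_[q] = \sum_(m <- msupp f) (f@_m * c m) *: 'X_[q - m].
  by apply: eq_bigr => m _; rewrite mderivmX scalerA.
have c_neq0 m : (m <= q)%MM -> c m != 0.
  move=> /mnm_lepP le_mq; rewrite /c ((pcharf0P _).1 charK0) -lt0n.
  by apply: prodn_gt0 => i; rewrite ffact_gt0.
have c_eq0 m : ~~ (m <= q)%MM -> c m = 0.
  move=> /forallPn[i]; rewrite -ltnNge => lt_qm.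
  by rewrite /c (bigD1 i) //= ffact_small.
rewrite actE; split=> [act0 m mf|nle]; last first.
  by rewrite big_seq big1 // => m /nle/c_eq0 ->; rewrite mulr0 scale0r.
apply/negP => le_mq; move: act0 => /(congr1 (mcoeff (q - m))).
rewrite mcoeff0 raddf_sum (bigD1_seq m) ?msupp_uniq //= big1 => [|n nm].
  rewrite addr0 mcoeffZ mcoeffX eqxx mulr1 => /eqP.
  by rewrite mulf_eq0 (negPf (c_neq0 _ le_mq)) orbF mcoeff_eq0 mf.
(* Subtraction is truncated, so [q - n] may equal [q - m] when [n] does not divide [q]; then
   [c n = 0] removes the term. *)
rewrite mcoeffZ mcoeffX; have [le_nq|/c_eq0->] := boolP (n <= q)%MM; last first.
  by rewrite mulr0 mul0r.
case: eqP => [e|]; rewrite ?mulr0 //; case/eqP: nm.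
by apply: (@addmI _ (q - n)%MM); rewrite submK // e submK.
Qed.

End Annihilator.

Theorem mainTheorem1 (K : fieldType) (d : nat)
    (charK0 : [pchar K] =i pred0)
    (M : set 'X_{1..d}) (M_nonempty : M !=set0) (M_antichain : antichain M)
    (I : set {mpoly K[d]})
    (I_monomial : monomial_ideal I) (I_zerodim : zero_dimensional I)
    (docle_I : docle I = M) :
  annihilator (monomials M) = I.
Proof.
have idI := monomial_ideal_is_ideal I_monomial.
apply/seteqP; split=> f.
  move=> annf; apply/monomial_idealP => // m mf; apply: contrapT => nIm.
  have [q qI le_mq] := dvd_docle I_monomial I_zerodim nIm.
  have /(diff_act_mpolyX_eq0 charK0) /(_ _ mf) : diff_act f 'X_[q] = 0.
    by apply: annf; exists q; rewrite -?docle_I.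
  by rewrite le_mq.
move=> If _ [q Mq <-]; apply/(diff_act_mpolyX_eq0 charK0) => // m mf; apply/negP => le_mq.
(* An element of the docle is outside [I], but [q] is a multiple of [m], which lies in [I]. *)
move: Mq; rewrite -docle_I => -[_]; apply.
apply: (is_ideal_mpolyX_dvd idI le_mq).
exact: (iffLR (monomial_idealP _ I_monomial) If).
Qed.
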